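(* Let $\mathcal A$ be an infinite Boolean algebra which has the weak subsequential separation property. Then $\mathcal A$ contains an independent family of cardinality continuum ($2^{\aleph_0}$).
   Context: An antichain in a Boolean algebra $\mathcal A$ is a subset $\mathcal B\subseteq\mathcal A$ that is pairwise disjoint: $A\wedge B=0$ for distinct $A,B\in\mathcal B$. A family $\{A_i:i\in I\}\subseteq\mathcal A$ is independent if $\bigwedge_{i\in F}A_i\wedge\bigwedge_{i\in G}A_i^{-1}\neq 0$ for all disjoint finite $F,G\subseteq I$, where $A^{-1}$ denotes the complement of $A$. $\mathcal A$ has the weak subsequential separation property if for every countably infinite antichain $\{A_n:n\in\mathbb N\}\subseteq\mathcal A$ there is $A\in\mathcal A$ such that both sets $\{n\in\mathbb N: A_n\le A\}$ and $\{n\in\mathbb N: A_n\wedge A=0\}$ are infinite. *)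

(* Defs.v *)
From mathcomp Require Import all_boot all_order finmap.
From mathcomp Require Import boolp classical_sets functions cardinality.

Set Implicit Arguments.
Unset Strict Implicit.
Unset Printing Implicit Defensive.

Import Order.LTheory.

Local Open Scope classical_set_scope.

Section BooleanAlgebra.
Context {disp : Order.disp_t} {A : ctbDistrLatticeType disp}.

Definition antichain (B : set A) : Prop :=
  forall x y : A, B x -> B y -> x <> y -> (x `&` y)%O = \bot%O.

(* Injectivity makes [range a] countably infinite and [a] an enumeration of it
   without repetition, so that counting indices is counting its elements. *)
Definition weak_subsequential_separation : Prop :=
  forall a : nat -> A, injective a -> antichain (range a) ->
  exists x : A,
    infinite_set [set n : nat | (a n <= x)%O] /\
    infinite_set [set n : nat | (a n `&` x)%O = \bot%O].

Definition independent (I : choiceType) (D : set I) (f : I -> A) : Prop :=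
  forall F G : {fset I},
    [set` F] `<=` D -> [set` G] `<=` D -> [disjoint F & G]%fset ->
    ((\meet_(i <- F) f i) `&` (\meet_(i <- G) ~` (f i)))%O <> \bot%O.

End BooleanAlgebra.

Arguments weak_subsequential_separation {disp} A.

(* Main.v *)
Require Import Defs.
From mathcomp Require Import all_boot all_order finmap.
From mathcomp Require Import boolp classical_sets functions cardinality.

(** Splitting infinite antichains yields a Cantor scheme of nonzero elements,
    hence a countable independent family, which we index by the nodes of the
    binary tree [2^{<omega}].  Subtracting from each member the members at the
    proper initial segments of its node gives elements [F_s] which are disjoint
    along every branch, but such that [F_{s_1}, ..., F_{s_k}] have a nonzero
    meet whenever the nodes [s_i] are pairwise incomparable.  For each branch
    [x] let [A_x] split the antichain [F_{x|0}, F_{x|1}, ...].  Given distinct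
    branches and signs, one finds arbitrarily long initial segments on which
    [F_{x|m}] lies below [A_x], or is disjoint from it, as the sign of [x]
    demands; these being eventually incomparable, the [A_x] are independent. *)

Set Implicit Arguments.
Unset Strict Implicit.

Import Order.Theory.

Local Open Scope classical_set_scope.

Lemma infinite_set_nat_ge (S : set nat) (N : nat) :
  infinite_set S -> exists2 n, S n & (N <= n)%N.
Proof.
move=> infS; apply: contrapT => h; apply: infS.
apply: (sub_finite_set _ (finite_II N)) => n Sn /=.
by rewrite ltnNge; apply/negP => le_Nn; apply: h; exists n.
Qed.

Lemma choice_in (T : Type) (P : T -> Prop) (Q : T -> T -> Prop) :
  (forall x, P x -> exists y, Q x y) ->
  exists f : T -> T, forall x, P x -> Q x (f x).
Proof.
move=> PQ; have [x|f fP] := @choice T T (fun x y => P x -> Q x y); last by exists f.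
by have [/PQ[y Qxy]|nPx] := pselect (P x); [exists y | exists x].
Qed.

Section IndependentFamilies.
Context {disp : Order.disp_t} {A : ctbDistrLatticeType disp}.

(** * Independent families and their sets of values *)

Lemma disj_le (x y x' y' : A) :
  (x <= x')%O -> (y <= y')%O -> (x' `&` y' = \bot)%O -> (x `&` y = \bot)%O.
Proof. by move=> lex ley h; apply: le_anti; rewrite le0x -h leI2. Qed.

(** A value taken at two indices could be required with both signs, and an element is disjoint from
    its complement. *)
Lemma independent_inj (I : choiceType) (f : I -> A) :
  independent setT f -> injective f.
Proof.
move=> indf x y eqf; apply: contrapT => /eqP nxy.
have := indf [fset x]%fset [fset y]%fset.
rewrite !big_seq_fset1 eqf meetxC; apply => //.
by rewrite fdisjoint1X inE.
Qed.

(** Finite sets of values pull back to finite sets of indices because [f] is injective, and the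
    nonzero meet over these indices lies below the meet over the values. *)
Lemma independent_range (I : choiceType) (f : I -> A) :
  independent setT f -> independent (range f) id.
Proof.
move=> indf F G sF sG FG.
pose pre (H : {fset A}) : {fset I} := fset_set (f @^-1` [set` H]).
have in_pre (H : {fset A}) x : (x \in pre H) = (f x \in H).
  rewrite in_fset_set; first by apply/idP/idP; rewrite inE.
  apply: finite_preimage; last exact: finite_fset.
  by move=> y z _ _; exact: independent_inj.
have FG' : [disjoint pre F & pre G]%fset.
  by apply/fdisjointP => x; rewrite !in_pre; apply: fdisjointP FG _.
have /(_ FG') := indf (pre F) (pre G) (fun _ _ => Logic.I) (fun _ _ => Logic.I).
apply: contra_not; apply: disj_le; apply/meetsP_seq => b bH _.
  have [x _ fx] := sF b bH.
  by rewrite -fx; apply: meets_inf_seq; rewrite ?in_pre ?fx.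
have [x _ fx] := sG b bH; rewrite -fx.
by apply: (meets_inf_seq (fun i => ~` (f i))%O); rewrite ?in_pre ?fx.
Qed.

(** * Splitting infinite principal ideals *)

Definition principal (a : A) : set A := [set b | (b <= a)%O].

(** Some nonzero [c] lies strictly below [a], or the ideal would have at most two elements. Every
    [b] below [a] is the join of its parts inside and outside [c], so the ideals of [c] and of its
    complement in [a] cannot both be finite. *)
Lemma infinite_principal_lt (a : A) :
  infinite_set (principal a) ->
  exists b, (b < a)%O /\ infinite_set (principal b).
Proof.
move=> infa.
have [c [nc0 ca]] : exists c, c <> \bot%O /\ (c < a)%O.
  apply: contrapT => h; apply: infa.
  apply: (@sub_finite_set _ _ [set \bot%O; a]) => // b /= ba.
  have [->|nb0] := pselect (b = \bot%O); first by left.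
  have [->|/eqP nba] := pselect (b = a); first by right.
  by case: h; exists b; rewrite lt_neqAle nba.
have da : (a `\` c < a)%O.
  rewrite lt_neqAle leBx andbT; apply/eqP => e; apply: nc0.
  have : (a `&` c)%O == \bot%O by rewrite (meet_eq0E_diff _ (lexx a)) e.
  by rewrite (meet_idPr (ltW ca)) => /eqP.
have [|fc] := pselect (infinite_set (principal c)); first by exists c.
exists (a `\` c)%O; split => // fd; apply: infa.
have : finite_set [set (b.1 `|` b.2)%O | b in principal c `*` principal (a `\` c)%O].
  by apply/finite_image/finite_setX => //; apply: contrapT.
apply: sub_finite_set => b /= ba; exists (b `&` c, b `\` c)%O.
  by split; rewrite /principal /= ?leIr // leBl.
by rewrite /= joinIB.
Qed.

(** Iterated descent gives a strictly decreasing sequence; its consecutive differences are nonzero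
    and pairwise disjoint. *)
Lemma infinite_principal_antichain (a : A) :
  infinite_set (principal a) ->
  exists e : nat -> A, [/\ forall n, (e n <= a)%O, forall n, e n <> \bot%O &
    forall m n, (m < n)%N -> (e m `&` e n = \bot)%O].
Proof.
move=> infa.
have [d dP] := choice_in infinite_principal_lt.
pose u n := iter n d a.
have infu n : infinite_set (principal (u n)).
  by elim: n => //= n /dP[].
have ltu n : (u n.+1 < u n)%O by have [] := dP _ (infu n).
have leu m n : (m <= n)%N -> (u n <= u m)%O.
  elim: n => [|n IHn]; first by rewrite leqn0 => /eqP->.
  rewrite leq_eqVlt => /predU1P[->//|/IHn]; apply: le_trans.
  exact: ltW (ltu n).
exists (fun n => u n `\` u n.+1)%O; split.
- by move=> n; apply: le_trans (leu 0 n _); rewrite ?leBx.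
- move=> n /eqP; rewrite diff_eq0 => h.
  by have := le_lt_trans h (ltu n); rewrite ltxx.
- move=> m n mn; apply: (disj_le (leBC _ _) (le_trans (leBx _ _) (leu _ _ mn))).
  exact: meetCx.
Qed.

Lemma disjoint_sequence_inj (e : nat -> A) :
  (forall n, e n <> \bot%O) ->
  (forall m n, (m < n)%N -> (e m `&` e n = \bot)%O) -> injective e.
Proof.
move=> e0 ed m n emn; case: (ltngtP m n) => // /ed.
  by rewrite emn meetxx => /e0.
by rewrite -emn meetxx => /e0.
Qed.

Lemma separated_disjoint_sequence (e : nat -> A) :
  weak_subsequential_separation A -> (forall n, e n <> \bot%O) ->
  (forall m n, (m < n)%N -> (e m `&` e n = \bot)%O) ->
  exists x, infinite_set [set n | (e n <= x)%O] /\
    infinite_set [set n | (e n `&` x = \bot)%O].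
Proof.
move=> wssA e0 ed; apply: wssA; first exact: disjoint_sequence_inj.
move=> _ _ [m _ <-] [n _ <-]; case: (ltngtP m n) => [/ed//|/ed|->//].
by rewrite meetC.
Qed.

(** An element separating an infinite antichain below [a] leaves infinitely many distinct members on
    either side. *)
Lemma infinite_principal_split (a : A) :
  weak_subsequential_separation A -> infinite_set (principal a) ->
  exists x, infinite_set (principal (a `&` x)%O) /\
    infinite_set (principal (a `\` x)%O).
Proof.
move=> wssA /infinite_principal_antichain[e [ea e0 ed]].
have [x [inf1 inf2]] := separated_disjoint_sequence wssA e0 ed.
have infe (S : set nat) b : infinite_set S ->
    (forall n, S n -> (e n <= b)%O) -> infinite_set (principal b).
  move=> infS Sb fb; apply: infS.
  apply: (sub_finite_set Sb); apply: (@finite_preimage _ _ (principal b)) => //.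
  by move=> m n _ _; apply: disjoint_sequence_inj.
exists x; split.
  by apply: (infe _ _ inf1) => n /= enx; rewrite lexI ea.
by apply: (infe _ _ inf2) => n /= enx; rewrite leBRL ea enx eqxx.
Qed.

(** * A countable independent sequence from a Cantor scheme *)

Lemma countable_independent_sequence :
  infinite_set [set: A] -> weak_subsequential_separation A ->
  exists G : nat -> A, forall (p : nat -> bool) (N : nat),
    exists c, c <> \bot%O /\
      forall i, (i < N)%N -> (c <= if p i then G i else ~` (G i))%O.
Proof.
move=> infA wssA.
have [s sP] := choice_in (fun a => @infinite_principal_split a wssA).
(* Only the first [n] values of [p] matter; a whole function stands for its initial segments of
   every length. *)
pose fix node (p : nat -> bool) n : A :=
  if n is m.+1 then
    if p m then (node p m `&` s (node p m))%O else (node p m `\` s (node p m))%O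
  else \top%O.
have inf_node p n : infinite_set (principal (node p n)).
  elim: n => [|n /sP[inf1 inf2]] /=; last by case: (p n).
  by apply: sub_infinite_set infA => x _; exact: lex1.
have node_le p m n : (m <= n)%N -> (node p n <= node p m)%O.
  elim: n => [|n IHn]; first by rewrite leqn0 => /eqP->.
  rewrite leq_eqVlt => /predU1P[->//|/IHn]; apply: le_trans => /=.
  by case: (p n); rewrite ?leIl ?leBx.
have eq_node p q n : (forall i, (i < n)%N -> p i = q i) -> node p n = node q n.
  elim: n => //= n IHn pq; rewrite pq // IHn // => i ltin.
  exact/pq/ltnW.
have node_disj p q n : (exists2 i, (i < n)%N & p i != q i) ->
    (node p n `&` node q n = \bot)%O.
  elim: n => [|n IHn] [i ltin npq] //.
  have [/IHn h|npq'] := pselect (exists2 i, (i < n)%N & p i != q i).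
    exact: disj_le (node_le _ _ _ (leqnSn n)) (node_le _ _ _ (leqnSn n)) h.
  have pq j : (j < n)%N -> p j = q j.
    by move=> ltjn; apply/eqP/negP => /negP njpq; apply: npq'; exists j.
  have {}npq : p n != q n.
    by move: ltin npq; rewrite ltnS leq_eqVlt => /predU1P[->//|/pq->]; rewrite eqxx.
  rewrite /= (eq_node _ _ _ pq); case: (p n) (q n) npq => [] [] //= _.
    by apply: disj_le (leIr _ _) (leBC _ _) (meetxC _).
  by apply: disj_le (leBC _ _) (leIr _ _) (meetCx _).
(* The default [true] supplies the bit following the word [t], so the join below runs over the nodes
   of level [i.+1] whose last bit is [true]. *)
pose up (i : nat) (t : i.-tuple bool) : nat -> bool := nth true t.
exists (fun i => \join_(t : i.-tuple bool) node (up i t) i.+1)%O => p N.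
have upN i t : up i t i = true by rewrite /up nth_default ?size_tuple.
exists (node p N); split => [nodeN|i ltiN].
  apply: (inf_node p N); rewrite nodeN.
  by apply: (sub_finite_set _ (finite_set1 \bot%O)) => x /=; rewrite /principal /= lex0 => /eqP.
(* The node of [p] at level [i.+1] is one of the joined nodes if [p i] holds; otherwise it differs
   from each of them at bit [i], hence is disjoint from their join. *)
apply: (le_trans (node_le p _ _ ltiN)); case: ifPn => [pi|npi].
  apply: (joins_min (j := [tuple of mkseq p i])) => //.
  rewrite (@eq_node _ p) // => j; rewrite ltnS leq_eqVlt => /predU1P[->|ltji].
    by rewrite upN.
  by rewrite /up /= nth_mkseq.
rewrite -disj_leC; apply/eqP; apply: joins_disjoint => t _.
by apply: node_disj; exists i; rewrite // upN (negbTE npi).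
Qed.

(** * From the countable sequence to a family indexed by branches *)

Lemma independent_continuum :
  infinite_set [set: A] -> weak_subsequential_separation A ->
  exists f : set nat -> A, independent setT f.
Proof.
move=> infA wssA.
have [G GP] := countable_independent_sequence infA wssA.
(* The number of the node [x|n], which determines both [n] and the values of [x] below [n]. *)
pose code (x : set nat) n := choice.pickle (mkseq (fun i => `[< x i >]) n).
have code_inj x y m n : code x m = code y n ->
    m = n /\ forall i, (i < n)%N -> x i = y i.
  move=> /(pcan_inj choice.pickleK) e.
  have mn : m = n by rewrite -(size_mkseq (fun i => `[< x i >]) m) e size_mkseq.
  split=> // i ltin; apply/propext; apply: asbool_eq_equiv.
  have := congr1 (nth true ^~ i) e.
  by rewrite !nth_mkseq ?mn.
pose F x n := (G (code x n) `&` \meet_(i < n) ~` (G (code x i)))%O.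
have F0 x n : F x n <> \bot%O.
  (* The sign is positive at the node [x|n] alone, and the bound exceeds the codes of all its
     initial segments. *)
  have [c [c0 cP]] := GP (fun k => k == code x n) (\max_(i < n.+1) code x i).+1.
  have {}cP i : (i < n.+1)%N ->
      (c <= if i == n then G (code x i) else ~` (G (code x i)))%O.
    move=> ltin; have := cP (code x i).
    rewrite ltnS (leq_bigmax (Ordinal ltin)) => /(_ isT).
    case: eqP => [/code_inj[-> _]|nc]; first by rewrite eqxx.
    by case: eqP => // i_n; case: nc; rewrite i_n.
  move=> Fx0; apply: c0; apply/eqP; rewrite -lex0 -Fx0 lexI.
  have := cP n (ltnSn n); rewrite eqxx => -> /=.
  apply/meetsP => i _; have := cP i (ltnW (ltn_ord i)).
  by rewrite ltn_eqF.
have Fdisj x m n : (m < n)%N -> (F x m `&` F x n = \bot)%O.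
  move=> mn; apply: disj_le (leIl _ _) _ (meetxC (G (code x m))).
  apply: le_trans (leIr _ _) _.
  exact: (meets_inf (fun i : 'I_n => ~` (G (code x i)))%O (j := Ordinal mn)).
have [f fP] := choice (fun x => separated_disjoint_sequence wssA (F0 x) (@Fdisj x)).
exists f => P Q _ _ PQ.
pose S := (P `|` Q)%fset.
(* A level by which the finitely many branches in [S] have separated. [D] picks a coordinate of
   difference, with dummy value 0 for equal branches. *)
have [N NP] : exists N, forall x y, x \in S -> y \in S ->
    (forall i, (i < N)%N -> x i = y i) -> x = y.
  have [D DP] : {D : set nat * set nat -> nat & forall xy,
      xy.1 (D xy) = xy.2 (D xy) -> xy.1 = xy.2}.
    apply: (@choice _ _ (fun xy i => xy.1 i = xy.2 i -> xy.1 = xy.2)) => -[x y].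
    have [->|nxy] := pselect (x = y); first by exists 0.
    have [i nxyi] : exists i, x i <> y i.
      by apply/existsNP => /funext.
    by exists i.
  exists (\max_(x <- S) \max_(y <- S) (D (x, y)).+1) => x y xS yS xy.
  apply: (DP (x, y)); apply: xy => /=.
  apply: leq_trans (leq_bigmax_seq x xS isT).
  exact: (leq_bigmax_seq y yS isT).
have [m mP] : {m : set nat -> nat & forall x, (N <= m x)%N /\
    if x \in P then (F x (m x) <= f x)%O else (F x (m x) <= ~` (f x))%O}.
  apply: (@choice _ _ (fun x n => (N <= n)%N /\
    if x \in P then (F x n <= f x)%O else (F x n <= ~` (f x))%O)) => x.
  have [inf1 inf2] := fP x; case: (x \in P).
    by have [n ? ?] := infinite_set_nat_ge N inf1; exists n.
  have [n /eqP + ?] := infinite_set_nat_ge N inf2.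
  by rewrite disj_leC; exists n.
(* Positive signs exactly at the chosen nodes [x|m x]. *)
have [c [c0 cP]] := GP (fun k => k \in [seq code x (m x) | x <- S])
  (\max_(x <- S) \max_(i < (m x).+1) code x i).+1.
(* If [x|i] is the node chosen for [y], then [i = m y] is at least [N], so [x = y]; thus every
   proper initial segment of [x|m x] gets a negative sign. *)
have {}cP x i : x \in S -> (i < (m x).+1)%N ->
    (c <= if i == m x then G (code x i) else ~` (G (code x i)))%O.
  move=> xS ltin; have := cP (code x i).
  have -> : (code x i < (\max_(x <- S) \max_(i < (m x).+1) code x i).+1)%N.
    rewrite ltnS; apply: leq_trans (leq_bigmax_seq x xS isT).
    exact: (leq_bigmax (Ordinal ltin)).
  move=> /(_ isT); case: ifPn => [/mapP[y yS /code_inj[im xy]]|nc].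
    have eqxy : x = y.
      apply: NP => // j ltjN; apply: xy; apply: leq_trans ltjN _.
      by have [] := mP y.
    by rewrite im -eqxy eqxx.
  case: eqP => // im; case/negP: nc; rewrite im.
  exact: (map_f (fun x => code x (m x)) xS).
have cF x : x \in S -> (c <= F x (m x))%O.
  move=> xS; rewrite lexI.
  have := cP x _ xS (ltnSn (m x)); rewrite eqxx => -> /=.
  apply/meetsP => i _; have := cP x i xS (ltnW (ltn_ord i)).
  by rewrite ltn_eqF.
apply: contra_not c0 => h; apply/eqP; rewrite -lex0 -h lexI.
apply/andP; split; apply/meetsP_seq => x xH _.
  apply: le_trans (cF x _) _; first by rewrite inE xH.
  by have [_] := mP x; rewrite xH.
apply: le_trans (cF x _) _; first by rewrite inE xH orbT.
have [_] := mP x; have /fdisjointP_sym/(_ x xH)/negbTE-> := PQ.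
by [].
Qed.

End IndependentFamilies.

Theorem theorem1p4 (disp : Order.disp_t) (A : ctbDistrLatticeType disp)
    (infA : infinite_set [set: A])
    (wssA : weak_subsequential_separation A) :
  exists B : set A, independent B id /\ (B #= [set: set nat])%card.
Proof.
have [f indf] := independent_continuum infA wssA.
exists (range f); split; first exact: independent_range.
by apply: inj_card_eq => x y _ _; apply: independent_inj.
Qed.
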